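(* For every $z\in\mathbb N\cup\{\infty\}$, $\mathrm{TD}(\mathrm{SR}^z,\mathrm{R}\Pi^z)=3$.
   Context: Fix a countably infinite set $X$ of variables and an alphabet $\Sigma$ (finite or countably infinite, disjoint from $X$), $z=|\Sigma|$. A pattern is a nonempty finite string over $X\cup\Sigma$; $\Pi^z$ is the class of all patterns over an alphabet of size $z$. A substitution is a morphism $h:(X\cup\Sigma)^*\to\Sigma^*$ fixing every letter; $L(\pi)=\{h(\pi)\}$ over all substitutions is the erasing pattern language. A pattern is regular if every variable occurs in it at most once; $\mathrm{R}\Pi^z$ is the class of regular patterns in $\Pi^z$. A pattern is simple block-regular if it has the shape $X_1a_1X_2\cdots a_{n-1}X_n$ with $X_i\in X^+$, $a_i\in\Sigma$, each $X_i$ containing a variable occurring in no other block; $\mathrm{SR}^z$ is the class of simple block-regular patterns in $\Pi^z$. A labelled example is $(w,+)$ or $(w,-)$ with $w\in\Sigma^*$; $\tau$ is consistent with a set $T$ of examples if $w\in L(\tau)$ for all $(w,+)\in T$ and $w\notin L(\tau)$ for all $(w,-)\in T$. A teaching set for $\pi\in\Pi$ w.r.t. a class $\Pi$ is a set $T$ consistent with $\pi$ such that every $\tau\in\Pi$ consistent with $T$ has $L(\tau)=L(\pi)$; $\mathrm{TD}(\pi,\Pi)$ is the minimum size of such a set ($\infty$ if none is finite) and $\mathrm{TD}(\Pi',\Pi)=\sup_{\pi\in\Pi'}\mathrm{TD}(\pi,\Pi)$. *)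

(* Defs.v *)
From mathcomp Require Import all_boot.
Set Implicit Arguments. Unset Strict Implicit. Unset Printing Implicit Defensive.

Section Patterns.
Variable A : countType.  (* the alphabet Sigma: finite or countably infinite *)

(* Variables are natural numbers (countably infinite set X, disjoint from A). *)
Definition symbol := (nat + A)%type.
Definition pattern := seq symbol.

Definition is_pattern (p : pattern) : Prop := p <> [::].

Definition subst (h : nat -> seq A) (p : pattern) : seq A :=
  flatten (map (fun s : symbol => match s with inl x => h x | inr a => [:: a] end) p).

Definition inL (p : pattern) (w : seq A) : Prop := exists h : nat -> seq A, subst h p = w.

Definition same_lang (p q : pattern) : Prop := forall w, inL p w <-> inL q w.

Definition regular (p : pattern) : Prop :=
  forall x : nat, count_mem (inl x : symbol) p <= 1.

Definition RPi (p : pattern) : Prop := is_pattern p /\ regular p.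

(* X_1 a_1 X_2 ... a_{n-1} X_n, given X_1 = b0 and rest = [(a_1,X_2);...;(a_{n-1},X_n)] *)
Definition blocks_pattern (b0 : seq nat) (rest : seq (A * seq nat)) : pattern :=
  map inl b0 ++ flatten (map (fun q : A * seq nat => inr q.1 :: map inl q.2) rest).

Definition SR (p : pattern) : Prop :=
  exists (b0 : seq nat) (rest : seq (A * seq nat)),
    let bs := b0 :: map snd rest in
    p = blocks_pattern b0 rest /\
    all (fun b => b != [::]) bs /\
    forall i, i < size bs ->
      exists x : nat, x \in nth [::] bs i /\
        forall j, j < size bs -> j != i -> x \notin nth [::] bs j.

(* labelled examples: (w, true) = (w,+), (w, false) = (w,-) *)
Definition example := (seq A * bool)%type.

Definition consistent (t : pattern) (T : seq example) : Prop :=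
  forall e, e \in T -> (inL t e.1 <-> e.2 = true).

(* T (a finite set, represented by a duplicate-free list) is a teaching set
   for p w.r.t. the class C *)
Definition teaching_set (C : pattern -> Prop) (p : pattern) (T : seq example) : Prop :=
  uniq T /\ consistent p T /\
  forall t, C t -> consistent t T -> same_lang t p.

Definition TD_is (C : pattern -> Prop) (p : pattern) (n : nat) : Prop :=
  (exists T, teaching_set C p T /\ size T = n) /\
  (forall T, teaching_set C p T -> n <= size T).

(* TD(C', C) = n : sup over p in C' of TD(p, C) equals the natural number n *)
Definition TD_class_is (C' C : pattern -> Prop) (n : nat) : Prop :=
  (forall p, C' p -> exists m, m <= n /\ TD_is C p m) /\
  (exists p, C' p /\ TD_is C p n).

End Patterns.

(* Main.v *)
Require Import Defs.
From mathcomp Require Import all_boot.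
From mathcomp Require Import zify.
From Stdlib Require Import Classical.
Set Implicit Arguments. Unset Strict Implicit. Unset Printing Implicit Defensive.

(** Let [w] be the word of constants of a simple block-regular pattern [p]; then
    [L(p)] is contained in the set [S(w)] of the words with subsequence [w]. A
    regular pattern is closed under inserting a letter [e] into its words, unless
    some maximal run of [e] and its two neighbours (possibly ends of the word) are
    consecutive constants of the pattern.

    If [L(p)] is not [S(w)] (a variable may be repeated inside its block), then
    inserting some [e] into some [v] in [L(p)] leaves [L(p)]. Substituting a power
    of [e] longer than [v] for all variables gives a second positive example without
    short runs of [e], and no regular pattern is consistent with these three.

    If [L(p) = S(w)], choose [v1] and [v2] in [S(w)] that share no such run with
    neighbours, and such that [w] is the only common subsequence of both above [w].
    Every regular pattern with [v1] and [v2] in its language has language [S(u)],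
    where [u] is its word of constants, and a rich enough word outside [S(w)]
    eliminates all [u] other than [w]. The choice of [v1] and [v2] depends on
    whether there are one, two, or at least three letters. *)

(** * Subsequences and upward closed sets of words *)

Section Subsequences.
Variable T : eqType.
Implicit Types (a : T) (s u v w C D : seq T).

Lemma subseq_cons_split a w u : subseq (a :: w) u ->
  exists D v, [/\ u = D ++ a :: v, a \notin D & subseq w v].
Proof.
elim: u => //= b u IH; case: eqP => [<- s|ne /IH [D [v [-> aD wv]]]].
  by exists [::], u.
by exists (b :: D), v; split=> //; rewrite inE negb_or aD andbT; apply/eqP.
Qed.

Lemma subseq_after_first a D C u v :
  a \notin C -> subseq (D ++ a :: u) (C ++ a :: v) -> subseq u v.
Proof.
move=> aC s; have {D s}: subseq (a :: u) (C ++ a :: v).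
  exact: subseq_trans (suffix_subseq _ _) s.
elim: C aC => [|c C IH] /=; first by rewrite eqxx.
by rewrite inE negb_or => /andP [/negPf -> /IH].
Qed.

Lemma subseq_before_last a C D u : a \notin D ->
  subseq (rcons u a) (C ++ a :: D) -> subseq u C.
Proof.
move=> aD; rewrite -subseq_rev rev_rcons rev_cat rev_cons cat_rcons => s.
rewrite -subseq_rev; apply: (@subseq_after_first a [::] (rev D)) => //.
by rewrite mem_rev.
Qed.

(* Any word that misses [w] splits, along the leftmost occurrences of the
   letters of [w], as [D_1 a_1 D_2 a_2 ... D_k] with [a_i] not in [D_i]; replacing
   every [D_i] by all of [v] without [a_i] gives a largest such word. *)
Fixpoint avoid w v : seq T :=
  if w is a :: w' then
    filter (predC1 a) v ++ (if w' is _ :: _ then a :: avoid w' v else [::])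
  else [::].

Lemma avoid_not_super w v : w != [::] -> ~~ subseq w (avoid w v).
Proof.
elim: w => // a w IH _; have aF : a \notin filter (predC1 a) v.
  by rewrite mem_filter /= eqxx.
case: w IH => [|b w] IH.
  by rewrite /= cats0 sub1seq.
apply/negP => /(@subseq_after_first a [::] _ _ _ aF).
exact/negP/IH.
Qed.

Lemma sub_avoid w u v : subseq u v -> ~~ subseq w u -> subseq u (avoid w v).
Proof.
elim: w u => [|a w IH] u uv; first by rewrite sub0seq.
case: (boolP (a \in u)) => [|au _]; last first.
  apply: subseq_trans (prefix_subseq _ _); rewrite subseq_filter uv andbT.
  by apply/allP => x xu /=; apply: contraNneq au => <-.
rewrite -sub1seq => /subseq_cons_split [D [u' [def_u aD _]]]; subst u => nw.
have nw' : ~~ subseq w u'.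
  apply: contra nw => wu'; apply: subseq_trans (suffix_subseq D _).
  by rewrite /= eqxx.
have u'v : subseq u' v.
  by apply: subseq_trans uv; apply: subseq_trans (suffix_subseq D _);
     exact: subseq_cons.
have := IH _ u'v nw'; case: w IH nw nw' => [|b w] _ _; first by rewrite sub0seq.
move=> _ s; rewrite /= -/(avoid (b :: w) v); apply: cat_subseq.
  rewrite subseq_filter (subseq_trans (prefix_subseq _ _) uv) andbT.
  by apply/allP => x xu /=; apply: contraNneq aD => <-.
by rewrite /= eqxx.
Qed.

Lemma insertion_closed_super (L : seq T -> Prop) w :
    (forall y1 e y2, L (y1 ++ y2) -> L (y1 ++ e :: y2)) -> L w ->
  forall y, subseq w y -> L y.
Proof.
move=> Lins Lw y; suff H z : L (z ++ w) -> subseq w y -> L (z ++ y).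
  exact: (H [::]).
elim: y w z {Lw} => [|b y IH] [|a w] z //=.
  move=> Lz _; rewrite -cat_rcons; apply: (IH [::]); rewrite ?sub0seq //.
  by rewrite cat_rcons; exact: Lins.
case: eqP => [->|_] Lz s; rewrite -cat_rcons.
  by apply: (IH w) => //; rewrite cat_rcons.
by apply: (IH (a :: w)) => //; rewrite cat_rcons; exact: Lins.
Qed.

End Subsequences.

(** * Regular patterns and insertion of a letter *)

Section Shapes.
Variable A : eqType.
Implicit Types (a e : A) (t : seq (option A)) (y v : seq A).

(* [None] is a variable of its own, so that these are regular patterns up to
   renaming of the variables. *)
Fixpoint matches t y : Prop :=
  match t with
  | [::] => y = [::]
  | Some a :: t' => exists2 y', y = a :: y' & matches t' y'
  | None :: t' => exists y1 y2, y = y1 ++ y2 /\ matches t' y2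
  end.

Lemma matches_cat t1 t2 y : matches (t1 ++ t2) y <->
  exists y1 y2, [/\ y = y1 ++ y2, matches t1 y1 & matches t2 y2].
Proof.
elim: t1 y => [|[a|] t1 IH] y /=.
- split=> [m|[y1 [y2 [-> -> m]]]]; by [exists [::], y|].
- split=> [[y' -> /IH [y1 [y2 [-> m1 m2]]]]|[y1 [y2 [-> [y' -> m1] m2]]]].
    by exists (a :: y1), y2; split=> //; exists y1.
  by exists (y' ++ y2) => //; apply/IH; exists y', y2.
- split=> [[z1 [z2 [-> /IH [y1 [y2 [-> m1 m2]]]]]]|].
    by exists (z1 ++ y1), y2; split=> //; [rewrite catA|exists z1, y1].
  move=> [y1 [y2 [-> [z1 [z2 [-> m1]]] m2]]].
  exists z1, (z2 ++ y2); rewrite catA; split=> //; apply/IH.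
  by exists z2, y2.
Qed.

Lemma matches_nseq r e y : matches (nseq r (Some e)) y <-> y = nseq r e.
Proof.
elim: r y => [|r IH] y //=.
by split=> [[y' -> /IH ->]|->] //; exists (nseq r e) => //; apply/IH.
Qed.

Lemma matches_letters t : matches t (pmap id t).
Proof.
elim: t => [|[a|] t IH] //=; first by exists (pmap id t).
by exists [::], (pmap id t).
Qed.

Lemma letters_sub t y : matches t y -> subseq (pmap id t) y.
Proof.
elim: t y => [|[a|] t IH] y /=; first by move->.
  by case=> y' -> /IH; rewrite /= eqxx.
by case=> y1 [y2 [-> /IH s]]; apply: subseq_trans (suffix_subseq _ _).
Qed.

(** The markers [None] let an end of the word count as a neighbour of a run. *)
Definition pad y : seq (option A) := None :: rcons (map Some y) None.

(** Either the point lies inside the value of a variable, which absorbs [e], or it falls between the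
    values of symbols, where the pattern is cut. *)
Lemma cut_or_insert t e y1 y2 : matches t (y1 ++ y2) ->
  matches t (y1 ++ e :: y2) \/
  exists t1 t2, [/\ t = t1 ++ t2, matches t1 y1 & matches t2 y2].
Proof.
elim: t y1 => [|[a|] t IH] y1 /=.
- by case: y1 => [|b y1] /= // ->; right; exists [::], [::].
- case: y1 => [|b y1] /= [y' def_y m].
    by right; exists [::], (Some a :: t); split=> //; exists y'.
  case: def_y m => <- <- /IH [m|[t1 [t2 [-> m1 m2]]]].
    by left; exists (y1 ++ e :: y2).
  by right; exists (Some b :: t1), t2; split=> //; exists y1.
- case=> z1 [z2 [def_y m]]; case: (leqP (size z1) (size y1)) => le_zy.
    have def_y1 : y1 = z1 ++ drop (size z1) y1.
      rewrite -{1}(cat_take_drop (size z1) y1); congr (_ ++ _).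
      by have := congr1 (take (size z1)) def_y; rewrite takel_cat // take_size_cat.
    move: def_y; rewrite def_y1 -catA => /eqP.
    rewrite eqseq_cat // eqxx /= => /eqP def_z2; subst z2.
    case: (IH _ m) => [m'|[t1 [t2 [-> m1 m2]]]].
      left; exists z1, (drop (size z1) y1 ++ e :: y2).
      by rewrite catA.
    right; exists (None :: t1), t2; split=> //.
    by exists z1, (drop (size z1) y1).
  left; exists (y1 ++ e :: drop (size y1) z1), z2; split=> //.
  rewrite -catA /=; congr (_ ++ _ :: _).
  have := congr1 (drop (size y1)) def_y.
  by rewrite drop_size_cat // drop_cat le_zy.
Qed.

Lemma trailing_run (t : seq (option A)) c :
  exists s i, t = s ++ nseq i c /\ (s = [::] \/ exists s' x, s = rcons s' x /\ x != c).
Proof.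
elim/last_ind: t => [|t x [s [i [def_t Hs]]]].
  by exists [::], 0; split=> //; left.
have [->|ne] := eqVneq x c; last first.
  by exists (rcons t x), 0; rewrite cats0; split=> //; right; exists t, x.
exists s, i.+1; split=> //; rewrite def_t -cats1 -catA; congr (_ ++ _).
by elim: (i) => //= j ->.
Qed.

Lemma leading_run (t : seq (option A)) c :
  exists s i, t = nseq i c ++ s /\ (s = [::] \/ exists x s', s = x :: s' /\ x != c).
Proof.
elim: t => [|x t [s [i [def_t Hs]]]].
  by exists [::], 0; split=> //; left.
have [->|ne] := eqVneq x c; last first.
  by exists (x :: t), 0; split=> //; right; exists x, t.
by exists s, i.+1; rewrite def_t.
Qed.

Lemma nseq_cons_comm (T : Type) i (x : T) s : nseq i x ++ x :: s = x :: nseq i x ++ s.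
Proof. by elim: i => //= i ->. Qed.

Lemma infix_pad_frozen e r t1 t2 :
    t1 = [::] \/ (exists s x, t1 = rcons s (Some x) /\ x != e) ->
    t2 = [::] \/ (exists x s, t2 = Some x :: s /\ x != e) ->
  exists b d, [/\ b != Some e, d != Some e &
    forall v, matches (t1 ++ nseq r (Some e) ++ t2) v ->
      infix (b :: rcons (nseq r (Some e)) d) (pad v)].
Proof.
move=> H1 H2.
have [b bNe Hb] : exists2 b, b != Some e & forall y, matches t1 y ->
    exists z, None :: map Some y = rcons z b.
  case: H1 => [->|[s [x [-> xe]]]].
    by exists None => // y ->; exists [::].
  exists (Some x) => // y; rewrite -cats1 => /matches_cat [y1 [_ [-> _ [_ -> ->]]]].
  by exists (None :: map Some y1); rewrite map_cat cats1.
have [d dNe Hd] : exists2 d, d != Some e & forall y, matches t2 y ->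
    exists z, rcons (map Some y) None = d :: z.
  case: H2 => [->|[x [s [-> xe]]]].
    by exists None => // y ->; exists [::].
  by exists (Some x) => // _ [y -> _]; exists (rcons (map Some y) None).
exists b, d; split=> // v /matches_cat [y1 [y2 [-> m1]]].
case/matches_cat => [y3 [y4 [-> /matches_nseq -> m2]]].
have [z1 E1] := Hb _ m1; have [z2 E2] := Hd _ m2.
apply/infixP; exists z1, z2.
rewrite /pad !map_cat !rcons_cat E2 -cat_cons E1 cat_rcons map_nseq /=.
by rewrite cat_rcons.
Qed.

(* The only obstruction to inserting [e] at a point of a matched word is that the
   maximal run of [e] around this point is, together with its two neighbours,
   a block of constants of the pattern. *)
Lemma insert_or_frozen t e y1 y2 : matches t (y1 ++ y2) ->
  matches t (y1 ++ e :: y2) \/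
  exists r b d, [/\ b != Some e, d != Some e &
    forall v, matches t v -> infix (b :: rcons (nseq r (Some e)) d) (pad v)].
Proof.
case/(cut_or_insert e) => [|[t1 [t2 [-> m1 m2]]]]; first by left.
have [s1 [i [def1 H1]]] := trailing_run t1 (Some e).
have [s2 [j [def2 H2]]] := leading_run t2 (Some e).
subst t1 t2.
(* A variable before the run takes the new [e] into its value, since moving [e] across a run of [e]
   does not change the word. *)
have {}H1 : matches ((s1 ++ nseq i (Some e)) ++ nseq j (Some e) ++ s2) (y1 ++ e :: y2) \/
    (s1 = [::] \/ exists s x, s1 = rcons s (Some x) /\ x != e).
  case: H1 => [->|[s [[x|] [def_s ne]]]]; first by right; left.
    by right; right; exists s, x.
  left; apply/matches_cat; exists (rcons y1 e), y2; rewrite cat_rcons; split=> //.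
  move: m1; rewrite def_s -cats1 => /matches_cat [x1 [x2 [-> m /matches_nseq ->]]].
  move: m => /matches_cat [x3 [x4 [-> m3 [z1 [z2 [-> z0]]]]]].
  apply/matches_cat; exists (rcons (x3 ++ z1 ++ z2) e), (nseq i e); split.
  - by rewrite cat_rcons -cats1 -catA nseq_cons_comm cats0.
  - apply/matches_cat; exists x3, (rcons (z1 ++ z2) e); rewrite rcons_cat.
    split=> //; exists (rcons (z1 ++ z2) e), [::]; by rewrite cats0.
  - exact/matches_nseq.
case: H1 => [|H1]; first by left.
have {}H2 : matches ((s1 ++ nseq i (Some e)) ++ nseq j (Some e) ++ s2) (y1 ++ e :: y2) \/
    (s2 = [::] \/ exists x s, s2 = Some x :: s /\ x != e).
  case: H2 => [->|[[x|] [s [def_s ne]]]]; first by right; left.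
    by right; right; exists x, s.
  left; apply/matches_cat; exists y1, (e :: y2); split=> //.
  move: m2; rewrite def_s => /matches_cat [x1 [x2 [-> /matches_nseq -> m]]].
  move: m => [z1 [z2 [-> m]]].
  apply/matches_cat; exists (nseq j e), (e :: z1 ++ z2); split.
  - by rewrite nseq_cons_comm.
  - exact/matches_nseq.
  - by exists (e :: z1), z2.
case: H2 => [|H2]; first by left.
right; have [b [d [bNe dNe H]]] := infix_pad_frozen (i + j) H1 H2.
exists (i + j), b, d; split=> // v; rewrite -catA => m; apply: H.
by rewrite nseqD -catA.
Qed.

End Shapes.

(** * Separating pairs of words *)

Section Separation.
Variable A : eqType.
Implicit Types (a e : A) (u v w : seq A).

(* Two words of the upward closure of [w] whose common regular patterns [t] are
   insertion closed, and hence determined by their letters [u]. *)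
Definition separating w v1 v2 : Prop :=
  [/\ subseq w v1, subseq w v2,
      forall e r b d, b != Some e -> d != Some e ->
        infix (b :: rcons (nseq r (Some e)) d) (pad v1) ->
        infix (b :: rcons (nseq r (Some e)) d) (pad v2) -> False
    & forall u, subseq w u -> subseq u v1 -> subseq u v2 -> u = w].

Lemma rcons_notin_cat (T : eqType) (c : T) m s z :
  c \notin m -> rcons m c = s ++ c :: z -> s = m.
Proof.
move=> cm; case/lastP: z => [|z x]; first by rewrite cats1 => /rcons_inj [->].
rewrite -rcons_cons -rcons_cat => /rcons_inj [def_m _].
by rewrite def_m mem_cat mem_head orbT in cm.
Qed.

Lemma infix_pad_None s v :
  infix (None :: rcons s None) (pad v) -> s = map Some v.
Proof.
have Nv : None \notin [seq Some x | x <- v] by apply/mapP => -[].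
case/infixP => [[|x z1] [z2]] /=.
  by rewrite cat_rcons => -[/(rcons_notin_cat Nv)].
case=> _ E; have def_z := rcons_notin_cat Nv E.
have := congr1 size E; rewrite def_z !(size_rcons, size_cat) /= !(size_rcons, size_cat) !size_map.
lia.
Qed.

(** With a single letter, a run bounded by other symbols lies between both end markers, so it is the
    whole word; but the two lengths differ. *)
Lemma separating_unary w a : (forall x y : A, x = y) -> separating w w (a :: w).
Proof.
move=> A1; split; [exact: subseq_refl|exact: subseq_cons| |].
- move=> e r [x|] [y|] //; try by rewrite (A1 x e) eqxx.
    by rewrite (A1 y e) eqxx.
  move=> _ _ /infix_pad_None E1 /infix_pad_None E2.
  by have := congr1 size E2; rewrite E1 /= !size_map; lia.
- by move=> u wu uw _; apply: (@subseq_anti A); rewrite wu uw.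
Qed.

(** * Two letters: alternating and doubled words *)

Section Binary.
Variable o : A -> A.
Hypothesis o_neq : forall x, o x != x.
Hypothesis o_other : forall x y, y != x -> y = o x.

(** Here [c] is the preceding letter: the other letter is put in wherever one would repeat, and once
    more at the end. *)
Fixpoint alternate c w : seq A :=
  if w is a :: w' then (if a == c then [:: o c; a] else [:: a]) ++ alternate a w'
  else [:: o c].

Definition double w : seq A := flatten [seq [:: a; a] | a <- w].

Fixpoint changes c u : nat :=
  if u is a :: u' then (c != a) + changes a u' else 0.

Lemma changes_subseq c u v : subseq u v -> changes c u <= changes c v.
Proof.
elim: v c u => [|b v IH] c [|a u] //=.
case: (eqVneq a b) => [-> /(IH b) | ab /(IH b) /=]; first by rewrite leq_add2l.
case: (eqVneq c a) => [->|_]; case: (eqVneq _ b) => [cb|_] //=; try lia.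
by rewrite eq_sym ab; lia.
Qed.

Lemma changes_double c w : changes c (double w) = changes c w.
Proof. by elim: w c => //= a w IH c; rewrite eqxx IH. Qed.

(** In an alternating word, a letter of [u] uses up at least one position if it differs from its
    predecessor in [u], and at least two if it repeats it. *)
Lemma alternating_subseq c u v :
  path (fun x y => x != y) c v -> subseq u v -> (size u).*2 <= size v + changes c u.
Proof.
elim: v c u => [|b v IH] c [|a u] //= /andP [cb pv].
case: (eqVneq a b) => [-> /(IH _ _ pv) | ab /(IH _ _ pv) /=]; first by rewrite cb; lia.
have -> : a = c by rewrite (o_other ab) -(o_other cb).
by rewrite eqxx eq_sym cb; lia.
Qed.

Lemma alternate_path c w : path (fun x y => x != y) c (alternate c w).
Proof.
elim: w c => [|a w IH] c /=; first by rewrite eq_sym o_neq.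
case: (eqVneq a c) => [->|ac] /=; first by rewrite eq_sym o_neq IH.
by rewrite eq_sym ac IH.
Qed.

Lemma size_alternate c w : size (alternate c w) + changes c w = (size w).*2.+1.
Proof.
elim: w c => [|a w IH] c //=; have := IH a; rewrite size_cat eq_sym.
by case: (eqVneq c a) => _ /=; lia.
Qed.

Lemma sub_alternate c w : subseq w (alternate c w).
Proof.
elim: w c => [|a w IH] c //=; rewrite -cat1s; apply: cat_subseq => //.
by case: ifP => _; rewrite sub1seq !inE eqxx ?orbT.
Qed.

Lemma sub_double w : subseq w (double w).
Proof.
by elim: w => //= a w IH; rewrite eqxx; apply: subseq_trans IH (subseq_cons _ _).
Qed.

Lemma double_no_triple w x y : x != y ->
  ~~ infix [:: Some x; Some y; Some x] (rcons (map Some (double w)) None).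
Proof.
move=> xy; elim: w => // a w IH.
rewrite -[rcons _ _]/(Some a :: Some a :: rcons (map Some (double w)) None).
rewrite !infix_consl !prefix_cons !negb_or.
apply/and3P; split=> //.
  by apply/negP=> /and3P [/eqP [Ex] /eqP [Ey] _]; rewrite Ex Ey eqxx in xy.
apply/negP => /andP [_]; rewrite /double; case: w {IH} => [|b w] /=.
  by [].
case/and3P => [/eqP [Ey] /eqP [Ex] _].
by rewrite Ex Ey eqxx in xy.
Qed.

(** For [f] and [l] the first and last letter of the original word, this relation and [double_rel]
    exclude each other on pairs with an end marker. *)
Definition alternate_rel f l : rel (option A) := fun x y =>
  match x, y with
  | Some x, Some y => x != y
  | None, Some y => y != f
  | Some x, None => x != l
  | None, None => false
  end.

Definition double_rel f l : rel (option A) := fun x y =>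
  match x, y with
  | Some x, Some y => true
  | None, Some y => y == f
  | Some x, None => x == l
  | None, None => false
  end.

Lemma alternate_rel_path f c w :
  path (alternate_rel f (last c w)) (Some c) (rcons (map Some (alternate c w)) None).
Proof.
elim: w c => [|a w IH] c /=; first by rewrite eq_sym o_neq.
case: (eqVneq a c) => [->|ac] /=; first by rewrite eq_sym !o_neq IH.
by rewrite eq_sym ac IH.
Qed.

Lemma double_rel_path f c w :
  path (double_rel f (last c w)) (Some c) (rcons (map Some (double w)) None).
Proof. by elim: w c => //= c; rewrite eqxx. Qed.

Lemma separating_binary a w :
  separating (a :: w) (alternate a (a :: w)) (double (a :: w)).
Proof.
split; [exact: sub_alternate|exact: sub_double| |].
- move=> e r b d be de i1 i2.
  have s1 : sorted (alternate_rel a (last a w)) (pad (alternate a (a :: w))).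
    by rewrite /= eqxx /= o_neq alternate_rel_path.
  have s2 : sorted (double_rel a (last a w)) (pad (double (a :: w))).
    by rewrite /= eqxx double_rel_path.
  have := infix_sorted i1 s1; have := infix_sorted i2 s2.
  (* Runs of length two or more do not alternate. Away from the ends, a run of length one gives a
     triple [x y x], absent from doubled words, and an empty run gives two equal adjacent
     letters. *)
  case: r i1 i2 => [|[|r]] i1 i2 /=; last by rewrite eqxx andbF.
    case: b be {i1 i2} => [x|] xe; case: d de => [y|] ye //=; rewrite ?andbT.
    + move=> _; rewrite eq_sym => yx.
      by rewrite (o_other yx) -(@o_other x e) ?eqxx // in ye; rewrite eq_sym.
    + by move=> ->.
    + by move=> ->.
  case: b be i1 i2 => [x|] xe i1 i2 /=; last by case/andP=> ->.
  case: d de i1 i2 => [y|] ye i1 i2 /=; last by case/andP=> ->; rewrite andbF.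
  move=> _ _; move: i2; rewrite (o_other xe) (o_other ye) /pad infix_consl.
  by rewrite (negPf (double_no_triple _ (o_neq e))).
(* The alternating word has length [2n + 1] minus the changes of the original word of length [n],
   and [u] has no more changes than that word, so [u] has length at most [n]. *)
- move=> u wu /(alternating_subseq (alternate_path _ _)) u1.
  move=> /(changes_subseq a); rewrite changes_double => u2.
  have u3 := size_alternate a (a :: w).
  have := size_subseq_leqif wu => -[le_wu eq_wu]; apply/esym/eqP; rewrite -eq_wu.
  by rewrite eqn_leq le_wu; lia.
Qed.

End Binary.

(** * Three or more letters: detours between consecutive letters *)

Section Detours.
Variable conn : option A -> option A -> seq A.
Hypothesis conn_l : forall x y, x \notin map Some (conn x y).
Hypothesis conn_r : forall x y, y \notin map Some (conn x y).

Fixpoint detour c w : seq A :=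
  if w is a :: w' then conn c (Some a) ++ a :: detour (Some a) w' else conn c None.

Lemma sub_detour c w : subseq w (detour c w).
Proof.
elim: w c => [|a w IH] c /=; first exact: sub0seq.
by apply: subseq_trans (suffix_subseq _ _); rewrite /= eqxx.
Qed.

Lemma detour_path (E : rel (option A)) c w :
    (forall x y, path E x (rcons (map Some (conn x y)) y)) ->
  path E c (rcons (map Some (detour c w)) None).
Proof.
move=> connE; elim: w c => [|a w IH] c //=.
by rewrite map_cat rcons_cat /= -cat_rcons cat_path connE last_rcons IH.
Qed.

Lemma conn_r_notin c a : a \notin conn c (Some a).
Proof. by apply: contra (conn_r c (Some a)) => H; rewrite map_f. Qed.

Lemma conn_l_notin c a : a \notin conn (Some a) c.
Proof. by apply: contra (conn_l (Some a) c) => H; rewrite map_f. Qed.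

(** Matched from the right, each letter lands at or before its own place, because the connection
    after that place avoids it. *)
Lemma detour_prefix D C a w :
  subseq (D ++ a :: w) (C ++ a :: detour (Some a) w) -> subseq D C.
Proof.
elim: w D C a => [|b w IH] D C a /=.
  by rewrite cats1; apply: subseq_before_last; exact: conn_l_notin.
rewrite -cat_rcons -cat_cons catA => /IH.
by apply: subseq_before_last; exact: conn_l_notin.
Qed.

End Detours.

(** Embedding [u] from both sides confines surplus letters to the same connection in both words, and
    one of these two connections is empty. *)
Lemma detours_common (conn1 conn2 : option A -> option A -> seq A) c w u :
    (forall x y, x \notin map Some (conn1 x y)) ->
    (forall x y, y \notin map Some (conn1 x y)) ->
    (forall x y, x \notin map Some (conn2 x y)) ->
    (forall x y, y \notin map Some (conn2 x y)) ->
    (forall x y, conn1 x y = [::] \/ conn2 x y = [::]) ->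
  subseq w u -> subseq u (detour conn1 c w) -> subseq u (detour conn2 c w) -> u = w.
Proof.
move=> l1 r1 l2 r2 c12.
have nil x y D : subseq D (conn1 x y) -> subseq D (conn2 x y) -> D = [::].
  by case: (c12 x y) => -> s1 s2; apply/eqP; rewrite -subseq0.
elim: w c u => [|a w IH] c u /=; first by move=> _; exact: nil.
case/subseq_cons_split => [D [u' [-> aD wu']]] s1 s2.
have E : u' = w.
  apply: (IH (Some a)) => //.
    by apply: subseq_after_first s1; exact: conn_r_notin.
  by apply: subseq_after_first s2; exact: conn_r_notin.
rewrite E in s1 s2 *.
by rewrite (nil c (Some a) D) //; [move: s1|move: s2]; apply: detour_prefix.
Qed.

Section Ternary.
Variables p q r : A.
Hypotheses (pq : p != q) (pr : p != r) (qr : q != r).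

(* The cycle [p -> q -> r -> p] together with [p -> x -> p] for all other [x],
   the end marker [None] included: both this relation and its complement join any
   two points by a path whose inner points are other points among [p], [q], [r]. *)
Definition hub : rel (option A) := fun x y =>
  if x == Some p then (y != Some p) && (y != Some r)
  else if x == Some q then y == Some r else y == Some p.

Definition hub_path (x y : option A) : seq A :=
  if x == Some p then
    if y == Some p then [:: q; r] else if y == Some r then [:: q] else [:: r]
  else if x == Some q then
    if y == Some p then [:: r] else if y == Some r then [:: p] else [:: r; p]
  else
    if y == Some p then [:: q] else if y == Some r then [:: p; q] else [:: p].

Lemma hub_pathP x y :
  [/\ x \notin map Some (hub_path x y), y \notin map Some (hub_path x y),
      hub x y -> path (fun x y => ~~ hub x y) x (rcons (map Some (hub_path x y)) y)
    & ~~ hub x y -> path hub x (rcons (map Some (hub_path x y)) y)].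
Proof.
have S (a b : A) : (Some a == Some b) = (a == b) by [].
have qp : (q == p) = false by rewrite eq_sym; apply: negPf.
have rp : (r == p) = false by rewrite eq_sym; apply: negPf.
have rq : (r == q) = false by rewrite eq_sym; apply: negPf.
have := (negPf pq, negPf pr, negPf qr) => -[[pq' pr'] qr'].
rewrite /hub_path /hub.
have [->|/negPf xp] := eqVneq x (Some p); last have [->|/negPf xq] := eqVneq x (Some q).
all: have [->|/negPf yp] := eqVneq y (Some p); last have [->|/negPf yr] := eqVneq y (Some r).
all: rewrite /= ?inE ?S ?eqxx ?qp ?rp ?rq ?pq' ?pr' ?qr' /=.
all: try rewrite ?xp ?xq; try rewrite ?xp; try rewrite ?yp ?yr; try rewrite ?yp.
all: rewrite /= ?inE ?S ?eqxx ?qp ?rp ?rq ?pq' ?pr' ?qr' /=; split=> //.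
Qed.

End Ternary.

Lemma separating_ternary (p q r : A) w : p != q -> p != r -> q != r ->
  exists v1 v2, separating w v1 v2.
Proof.
move=> pq pr qr; have P := hub_pathP pq pr qr.
(* [c1] makes the first word a walk in [hub], [c2] makes the second a walk in its complement, so the
   padded words share no adjacent pair. *)
pose c1 x y := if hub p q r x y then [::] else hub_path p q r x y.
pose c2 x y := if hub p q r x y then hub_path p q r x y else [::].
exists (detour c1 None w), (detour c2 None w); split.
- exact: sub_detour.
- exact: sub_detour.
- move=> e n b d _ _ /infix_sorted i1 /infix_sorted i2.
  have s1 : sorted (hub p q r) (b :: rcons (nseq n (Some e)) d).
    apply: i1; apply: detour_path => x y; rewrite /c1.
    by case: ifP => [h|/negbT h]; rewrite /= ?h //; case: (P x y) => _ _ _; apply.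
  have s2 : sorted (fun x y => ~~ hub p q r x y) (b :: rcons (nseq n (Some e)) d).
    apply: i2; apply: detour_path => x y; rewrite /c2.
    by case: ifP => [h|/negbT h]; rewrite /= ?h //; case: (P x y) => _ _ H _; apply: H.
  by case: n s1 s2 {i1 i2} => [|n] /= /andP [-> _].
- move=> u; apply: detours_common => x y; rewrite /c1 /c2; case: ifP => // _;
    try (by case: (P x y)); by [left|right].
Qed.

Lemma separating_exists w : w != [::] -> exists v1 v2, separating w v1 v2.
Proof.
case: w => // a w _.
case: (classic (forall x y : A, x = y)) => [A1|].
  by exists (a :: w), (a :: a :: w); exact: separating_unary.
move=> /not_all_ex_not [p] /not_all_ex_not [q] /eqP pq.
case: (classic (forall r, r = p \/ r = q)) => [A2|].
  pose o x := if x == p then q else p.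
  have o_neq x : o x != x.
    by rewrite /o; case: (eqVneq x p) => [->|]; rewrite eq_sym.
  have o_other x y : y != x -> y = o x.
    rewrite /o; case: (A2 x) => ->; case: (A2 y) => ->; rewrite ?eqxx //.
    by rewrite [q == p]eq_sym (negPf pq).
  exists (alternate o a (a :: w)), (double (a :: w)).
  exact: separating_binary.
move=> /not_all_ex_not [r] /not_or_and [/eqP rp /eqP rq].
by apply: (@separating_ternary p q r); rewrite // eq_sym.
Qed.

End Separation.

(** * Long runs of one letter *)

Section Runs.
Variable T : eqType.
Implicit Types (e b d : T).

Lemma prefix_run_length e d r k s : d != e ->
  prefix (rcons (nseq r e) d) (nseq k e ++ s) -> k <= r.
Proof.
move=> de; elim: r k => [|r IH] [|k] //=; last by case/andP=> _ /IH.
by rewrite (negPf de).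
Qed.

(** As [b] and [d] differ from [e], the block starts at some [q.1] and its run includes the whole
    run of length [q.2] after it. *)
Lemma infix_run_length e b d N r z (l : seq (T * nat)) :
    all (fun q => N <= q.2) l -> b != e -> d != e ->
    infix (b :: rcons (nseq r e) d) (flatten [seq q.1 :: nseq q.2 e | q <- l] ++ [:: z]) ->
  N <= r.
Proof.
move=> Nl be de; elim: l Nl => [_ /size_infix|[x k] l IH /andP [Nk /IH {}IH]].
  by rewrite /= size_rcons.
rewrite [flatten _]/= cat_cons infix_consl prefix_cons -catA => /orP [|].
  by case/andP=> _ /(prefix_run_length de); exact: leq_trans.
elim: (k) => [|j IHj]; first exact: IH.
rewrite -[nseq j.+1 e]/(e :: nseq j e) cat_cons infix_consl prefix_cons.
by rewrite (negPf be).
Qed.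

End Runs.

(** * Teaching sets and the lower bound *)

Section Teaching.
Variable A : countType.
Implicit Types (p t : pattern A) (h : nat -> seq A) (y w : seq A).

(** Forgetting variable names keeps the language of a regular pattern, whose variables take their
    values independently. *)
Definition shape p : seq (option A) :=
  [seq if s is inr a then Some a else None | s <- p].

Definition letters p : seq A := pmap id (shape p).

Lemma subst_cons h (s : symbol A) p :
  subst h (s :: p) = (match s with inl x => h x | inr a => [:: a] end) ++ subst h p.
Proof. by case: s. Qed.

Lemma subst_cat h p1 p2 : subst h (p1 ++ p2) = subst h p1 ++ subst h p2.
Proof. by rewrite /subst map_cat flatten_cat. Qed.

Lemma eq_in_subst h h' p :
  (forall x, inl x \in p -> h x = h' x) -> subst h p = subst h' p.
Proof.
move=> hh'; congr flatten; apply/eq_in_map => -[x|a] // xp.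
exact: hh'.
Qed.

Lemma inL_matches p y : inL p y -> matches (shape p) y.
Proof.
case=> h <-; elim: p => //= -[x|a] p IH; rewrite subst_cons /=.
  by exists (h x), (subst h p).
by exists (subst h p).
Qed.

Lemma matches_inL p y : regular p -> matches (shape p) y -> inL p y.
Proof.
elim: p y => [|s p IH] y reg /=; first by move->; exists (fun=> [::]).
have regp : regular p by move=> x; apply: leq_trans (reg x); rewrite /= leq_addl.
case: s reg => [x|a] reg; last first.
  case=> y' -> /(IH _ regp) [h <-]; by exists h.
case=> y1 [y2 [-> /(IH _ regp) [h <-]]].
have xp : inl x \notin p.
  by have := reg x; rewrite /= eqxx add1n ltnS leqn0 -(rwP eqP) => /count_memPn.
exists (fun z => if z == x then y1 else h z); rewrite subst_cons eqxx; congr (_ ++ _).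
by apply: eq_in_subst => z zp; case: eqP zp xp => // -> ->.
Qed.

Lemma inL_letters p : inL p (letters p).
Proof.
exists (fun=> [::]); elim: p => //= -[x|a] p IH; by rewrite subst_cons IH.
Qed.

Lemma inL_super p y : inL p y -> subseq (letters p) y.
Proof. by move/inL_matches/letters_sub. Qed.

Lemma teaching_setI (C : pattern A -> Prop) p (T : seq (example A)) :
    consistent p T -> (forall t, C t -> consistent t T -> same_lang t p) ->
  exists T', teaching_set C p T' /\ size T' <= size T.
Proof.
move=> cp Ct; exists (undup T); split; last exact: size_undup.
split; [exact: undup_uniq|split=> [e|t t_C ct]].
  by rewrite mem_undup; exact: cp.
by apply: Ct => // e eT; apply: ct; rewrite mem_undup.
Qed.

Lemma consistent3 t y1 y2 y3 :
  consistent t [:: (y1, true); (y2, true); (y3, false)] <->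
  [/\ inL t y1, inL t y2 & ~ inL t y3].
Proof.
split=> [c|[i1 i2 i3] e].
  split; first by apply/(c (y1, true)); rewrite ?inE ?eqxx.
    by apply/(c (y2, true)); rewrite ?inE ?eqxx ?orbT.
  by move/(c (y3, false)); rewrite !inE eqxx !orbT => /(_ isT).
by rewrite !inE => /or3P [] /eqP ->.
Qed.

Lemma pad_subst_run N e b0 (rest : seq (A * seq nat)) :
  pad (subst (fun=> nseq N e) (blocks_pattern b0 rest)) =
  flatten [seq q.1 :: nseq q.2 (Some e) |
            q <- (None, N * size b0) :: [seq (Some q.1, N * size q.2) | q <- rest]]
  ++ [:: None].
Proof.
have sb b : subst (fun=> nseq N e) [seq inl x | x <- b] = nseq (N * size b) e.
  by elim: b => [|x b IH]; rewrite ?muln0 //= subst_cons IH mulnS nseqD.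
rewrite /pad /= cats1 /blocks_pattern subst_cat sb map_cat map_nseq.
congr (_ :: rcons (_ ++ _) _).
elim: rest => //= -[a b] rest IH /=; congr (_ :: _).
by rewrite -/(subst (fun=> nseq N e) _) subst_cat sb map_cat map_nseq IH.
Qed.

Lemma teach_not_super b0 (rest : seq (A * seq nat)) (p := blocks_pattern b0 rest) y1 e y2 :
    all (fun b => b != [::]) (b0 :: map snd rest) ->
    inL p (y1 ++ y2) -> ~ inL p (y1 ++ e :: y2) ->
  exists T, teaching_set (@RPi A) p T /\ size T <= 3.
Proof.
(* [N] exceeds the length of the first example, hence of any frozen run in it, while the second
   example only allows runs of length at least [N]. *)
move=> bs iL niL; pose N := (size (y1 ++ y2)).+1.
pose v := subst (fun=> nseq N e) p.
apply: (@teaching_setI _ _ [:: (y1 ++ y2, true); (v, true); (y1 ++ e :: y2, false)]).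
  by apply/consistent3; split=> //; exists (fun=> nseq N e).
move=> t [_ reg] /consistent3 [i1 i2 ni3]; case: ni3; apply: matches_inL => //.
case: (insert_or_frozen e (inL_matches i1)) => // -[r [b [d [be de H]]]].
have := H _ (inL_matches i1) => /size_infix.
rewrite /= !size_rcons size_nseq size_map !ltnS => r_le.
have := H _ (inL_matches i2); rewrite /v /p pad_subst_run.
move/infix_run_length => /(_ N); rewrite be de => N_le.
suff /N_le : all (fun q : option A * nat => N <= q.2)
    ((None, N * size b0) :: [seq (Some q.1, N * size q.2) | q <- rest]).
  by move=> /(_ isT isT); rewrite ltnNge r_le.
move: bs => /= /andP [b0N]; rewrite all_map => restN; rewrite leq_pmulr ?lt0n ?size_eq0 //=.
by rewrite all_map; apply: sub_all restN => q /= qN; rewrite leq_pmulr // lt0n size_eq0.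
Qed.

Lemma teach_super p : (forall y, subseq (letters p) y -> inL p y) ->
  exists T, teaching_set (@RPi A) p T /\ size T <= 3.
Proof.
move=> up; case: (eqVneq (letters p) [::]) => [p0|pN].
  (* The empty word alone suffices here: a pattern generating it has only variables, and one of them
     can produce any word. *)
  have all_inL y : inL p y by apply: up; rewrite p0 sub0seq.
  have [||T [tT sT]] := @teaching_setI (@RPi A) p [:: ([::], true)].
  - by move=> e; rewrite inE => /eqP ->.
  - move=> t [tN reg] c y; split=> // _; apply: matches_inL => //.
    have /inL_super : inL t [::] by apply/(c ([::], true)); rewrite ?inE.
    rewrite subseq0 /letters; case: t tN {reg c} => // s t _ /eqP s0.
    have n0 : all (fun x => x == None) (shape (s :: t)).
      by elim: (shape _) s0 => //= -[].
    case: s n0 {s0} => // x; exists y, [::]; rewrite cats0; split=> //.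
    by move: n0 => /= ; elim: t => //= -[x'|a] //= t IH /IH; exists [::], [::].
  by exists T; split=> //; apply: leq_trans sT _.
have [v1 [v2 [w1 w2 frozen sep]]] := separating_exists pN.
apply: (@teaching_setI _ _
  [:: (v1, true); (v2, true); (avoid (letters p) v1, false)]).
  apply/consistent3; split; [exact: up|exact: up|].
  by move/inL_super; exact/negP/avoid_not_super.
move=> t [_ reg] /consistent3 [i1 i2 ni3].
(* A run blocking an insertion would occur in both [v1] and [v2]. *)
have up_t y : subseq (letters t) y -> inL t y.
  move: y; apply: insertion_closed_super (inL_letters t) => y1 e y2 i.
  apply: matches_inL => //.
  case: (insert_or_frozen e (inL_matches i)) => // -[r [b [d [be de H]]]].
  by case: (frozen e r b d be de); apply: H; exact: inL_matches.
(* Otherwise the constants of [t], a subsequence of [v1], lie below the negative example, which [t]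
   would then generate. *)
have pt : subseq (letters p) (letters t).
  apply/negPn/negP => npt; apply: ni3; apply: up_t.
  by apply: sub_avoid npt; exact: inL_super.
have tp := sep _ pt (inL_super i1) (inL_super i2).
by move=> y; split=> /inL_super; [rewrite tp; exact: up|rewrite -tp; exact: up_t].
Qed.

Lemma SR_teachable p : SR p -> exists T, teaching_set (@RPi A) p T /\ size T <= 3.
Proof.
move=> [b0 [rest [def_p [bs _]]]].
case: (classic (forall y1 e y2, inL p (y1 ++ y2) -> inL p (y1 ++ e :: y2))) => [ins|].
  by apply: teach_super; exact: insertion_closed_super ins (inL_letters p).
move=> /not_all_ex_not [y1] /not_all_ex_not [e] /not_all_ex_not [y2].
by rewrite def_p => H; have [i ni] := imply_to_and _ _ H; exact: teach_not_super bs i ni.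
Qed.

Lemma TD_exists (C : pattern A -> Prop) p T : teaching_set C p T ->
  exists m, m <= size T /\ TD_is C p m.
Proof.
have [n] := ubnP (size T); elim: n T => // n IH T sT tT.
case: (classic (exists T', teaching_set C p T' /\ size T' < size T)) => [|noT].
  case=> T' [tT' lt_T']; have [] := IH T' _ tT'; first exact: leq_trans lt_T' sT.
  by move=> m [le_m tm]; exists m; split=> //; apply: leq_trans le_m (ltnW lt_T').
exists (size T); split=> //; split=> [|T' tT']; first by exists T.
by rewrite leqNgt; apply/negP => lt_T'; apply: noT; exists T'.
Qed.

Lemma inL_constant v y : inL (map inr v) y <-> y = v.
Proof.
have c h : subst h (map inr v) = v by elim: v => //= a v IH; rewrite subst_cons IH.
by split=> [[h <-]|->] //; exists (fun=> [::]).
Qed.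

Lemma constant_RPi v : v != [::] -> RPi (map inr v : pattern A).
Proof.
move=> vN; split; first by case: v vN.
by move=> x; rewrite leqW // leqn0; apply/eqP/count_memPn; apply/mapP => -[].
Qed.

(* Without negative examples the pattern consisting of one variable is consistent;
   with a single positive example [v], the constant pattern [v] is. *)
Lemma teaching_set_size (p : pattern A) y1 y2 y3 T :
    inL p y1 -> inL p y2 -> y1 != y2 -> ~ inL p y3 -> ~ inL p [::] ->
  teaching_set (@RPi A) p T -> 3 <= size T.
Proof.
move=> i1 i2 y12 ni3 ni0 [uT [cT TC]].
have var_inL y : inL [:: inl 0 : symbol A] y by exists (fun=> y); rewrite /subst /= cats0.
have neg : 0 < count (fun e : example A => ~~ e.2) T.
  rewrite -has_count; apply/negPn/negP => /hasPn allT; apply: ni3.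
  apply/(TC [:: inl 0]) => //; first by split=> // -[].
  by move=> e eT; split=> // _; apply/negPn; exact: allT.
have pos : 1 < count (fun e : example A => e.2) T.
  rewrite ltnNge; apply/negP => le1.
  (* [v] is the word of the only positive example, or [y1] if there is none. *)
  have [v iv vT] : exists2 v, inL p v & forall e, e \in T -> e.2 -> e.1 = v.
    case: (boolP (has (fun e : example A => e.2) T)) => [/hasP [[v b] vT /= b1]|/hasPn noT].
      exists v; first by apply/(cT _ vT).
      move=> e eT e1; apply/eqP/negPn/negP => ne.
      suff : 2 <= count (fun e : example A => e.2) T by rewrite leqNgt ltnS le1.
      rewrite -size_filter -[2]/(size [:: e; (v, b)]); apply: uniq_leq_size.
        by rewrite /= inE andbT; apply: contra ne => /eqP ->.
      by apply/allP; rewrite /= !mem_filter /= e1 eT vT b1.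
    by exists y1 => // e /noT /negPf ->.
  have vN : v != [::] by apply/eqP => v0; apply: ni0; rewrite -v0.
  have same : same_lang (map inr v) p.
    apply: TC; first exact: constant_RPi.
    move=> e eT; split=> [/inL_constant def_e|e1].
      by apply/(cT _ eT); rewrite def_e.
    by apply/inL_constant; exact: vT.
  move/same/inL_constant: i1 => e1; move/same/inL_constant: i2 => e2.
  by rewrite e1 e2 eqxx in y12.
by rewrite -(count_predC (fun e : example A => e.2)) -[3]/(2 + 1) leq_add.
Qed.

End Teaching.

(* For every nonempty alphabet A (finite of size z >= 1, or countably infinite),
   TD(SR^z, RPi^z) = 3. *)
Theorem mainTheorem3 (A : countType) (a0 : A) :
  TD_class_is (@SR A) (@RPi A) 3.
Proof.
have TD_le p : SR p -> exists m, m <= 3 /\ TD_is (@RPi A) p m.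
  move=> /SR_teachable [T [tT sT]]; have [m [le_m tm]] := TD_exists tT.
  by exists m; split=> //; apply: leq_trans sT.
(* This language contains [a0] and [a0 a0] but not the empty word, as the lower bound requires. *)
split=> //; pose p : pattern A := [:: inl 0; inr a0; inl 1].
have SRp : SR p.
  exists [:: 0], [:: (a0, [:: 1])]; split=> //; split=> // -[|[|i]] // _.
    by exists 0; split=> // -[|[|j]].
  by exists 1; split=> // -[|[|j]].
exists p; split=> //; have [m [le_m [[T [tT sT]] min_m]]] := TD_le _ SRp.
suff m3 : 3 <= m by have -> : 3 = m by [apply/eqP; rewrite eqn_leq m3 le_m]; split=> //; exists T.
have ni0 : ~ inL p [::] by move/inL_super.
rewrite -sT; apply: (@teaching_set_size _ p [:: a0] [:: a0; a0] [::]) tT => //.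
  by exists (fun=> [::]).
  by exists (fun n => if n == 0 then [:: a0] else [::]).
by rewrite eqseq_cons andbF.
Qed.
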